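(* For every tree $T$ with $n\ge1$ vertices there exists a monotone (and hence planar) straight-line drawing of $T$ in which the vertices are placed at distinct integer grid points lying in a grid of $\lfloor\frac{3}{4}(n+2)\rfloor\times\lfloor\frac{3}{4}(n+2)\rfloor$ points, i.e., the $x$-coordinates of the vertices span an interval of length at most $\lfloor\frac{3}{4}(n+2)\rfloor-1$, and likewise the $y$-coordinates.
   Context: A path $p_0,\dots,p_k$ in a straight-line drawing is monotone if there is a line $\ell$ such that the orthogonal projections of $p_0,\dots,p_k$ onto $\ell$ appear along $\ell$ in this order. A straight-line drawing of a graph is monotone if every pair of vertices is connected by a monotone path. No order of neighbors around vertices is prescribed. *)

(* Defs.v *)
From Stdlib Require Import ZArith Reals.
From mathcomp Require Import all_boot.

Set Implicit Arguments.
Unset Strict Implicit.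
Unset Printing Implicit Defensive.

Definition simple_graph (T : finType) (e : rel T) : Prop :=
  symmetric e /\ irreflexive e.

Definition has_cycle (T : finType) (e : rel T) : Prop :=
  exists (x : T) (p : seq T),
    (2 <= size p)%N /\ uniq (x :: p) /\ path e x p /\ e (last x p) x.

Definition is_tree (T : finType) (e : rel T) : Prop :=
  simple_graph e /\ (forall x y : T, connect e x y) /\ ~ has_cycle e.

Definition point := (Z * Z)%type.

(* Signed length of the orthogonal projection of the vector q - p onto
   the direction d (up to the positive factor |d|). *)
Definition proj_diff (d : R * R) (p q : point) : R :=
  Rplus (Rmult (fst d) (IZR (fst q - fst p)%Z)) (Rmult (snd d) (IZR (snd q - snd p)%Z)).

(* The path x = p_0, p_1, ..., p_k (the list p = [p_1; ...; p_k]) is monotone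
   in the drawing pos: there is a line (with direction d) such that the
   orthogonal projections of pos p_0, ..., pos p_k appear along it in this
   order (strictly increasing along d). *)
Definition monotone_path (T : Type) (pos : T -> point) (x : T) (p : seq T) : Prop :=
  exists d : R * R,
    forall i : nat, (i < size p)%N ->
      Rlt R0 (proj_diff d (pos (nth x (x :: p) i)) (pos (nth x (x :: p) i.+1))).

Definition monotone_drawing (T : finType) (e : rel T) (pos : T -> point) : Prop :=
  forall u v : T, exists p : seq T,
    path e u p /\ last u p = v /\ monotone_path pos u p.

Definition in_grid (T : Type) (pos : T -> point) (N : nat) : Prop :=
  exists x0 y0 : Z, forall v : T,
    (x0 <= fst (pos v) <= x0 + Z.of_nat N - 1)%Z /\
    (y0 <= snd (pos v) <= y0 + Z.of_nat N - 1)%Z.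

(* Main.v *)
Require Import Defs.
From Stdlib Require Import ZArith Reals Lia.
From mathcomp Require Import all_boot.

(* The path between two vertices is monotone as soon as the edge
   vectors of any two sibling subtrees are separated by a line through the
   origin, so one only has to choose edge vectors.

   An ordered forest with [M] nodes can be drawn with all its vectors in an open
   quadrant and inside an [M x M] box.  To draw it in the cone spanned by [a] and
   [b], run a stem in direction [a + b] into the subtree where the sizes balance,
   and draw the parts left and right of it in the cones [(a, a + b)] and
   [(a + b, b)].

   Root the tree, with [m] edges, at a centroid and merge the subtrees into three
   groups of sizes [c1, c2 >= c3], each at most [(m + 1) / 2].  Groups 1 and 2
   contain root paths of lengths [s1 >= s2] (after exchanging them if necessary)
   such that what hangs off each path splits into two parts of size at most half
   of the group.  Path 1 goes east, with everything hanging off it in the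
   south-east quadrant; path 2 goes north, with its two parts in the north-east
   and north-west quadrants; group 3 goes in the south-west quadrant.  The width
   is then about [c1 + max (c2 / 2) c3], the height about
   [s2 + c2 / 2 + (c1 - s1)] or [c2 + c3], and all these are at most [3 m / 4]
   up to rounding. *)

Set Implicit Arguments.
Unset Strict Implicit.
Unset Printing Implicit Defensive.

(** * Ordered forests *)

(* [Cons a ch sib] is the tree with root [a] and children [ch], followed by the
   trees [sib].  The roots hang from a common parent outside the forest, so that
   nodes stand for edges. *)
Inductive forest (A : Type) : Type :=
| Nil
| Cons (a : A) (ch sib : forest A).

Arguments Nil {A}.

Fixpoint labels A (F : forest A) : seq A :=
  if F is Cons a ch sib then a :: labels ch ++ labels sib else [::].

Fixpoint fcat A (F G : forest A) : forest A :=
  if F is Cons a ch sib then Cons a ch (fcat sib G) else G.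

Fixpoint fmap A B (f : A -> B) (F : forest A) : forest B :=
  if F is Cons a ch sib then Cons (f a) (fmap f ch) (fmap f sib) else Nil.

Notation erase := (fmap fst).

Fixpoint adj (T : Type) (e : rel T) (r : T) (F : forest T) : Prop :=
  if F is Cons a ch sib then [/\ e r a, adj e a ch & adj e r sib] else True.

Lemma fcatA A (F G H : forest A) : fcat F (fcat G H) = fcat (fcat F G) H.
Proof. by elim: F => //= a ch _ sib ->. Qed.

Lemma labels_cat A (F G : forest A) : labels (fcat F G) = labels F ++ labels G.
Proof. by elim: F => //= a ch _ sib ->; rewrite catA. Qed.

Lemma adj_cat (T : Type) (e : rel T) r F G :
  adj e r (fcat F G) <-> adj e r F /\ adj e r G.
Proof.
elim: F => [|a ch _ sib IH] /=; first by split=> [|[]].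
split=> [[h1 h2 /IH [h3 h4]] | [[h1 h2 h3] h4]]; first by [].
by split=> //; apply/IH.
Qed.

Lemma fmap_cat A B (f : A -> B) F G : fmap f (fcat F G) = fcat (fmap f F) (fmap f G).
Proof. by elim: F => //= a ch _ sib ->. Qed.

(** Needed to cut one drawing of everything on a side of a stem into the pieces that hang at the
    stem's vertices. *)
Lemma fmap_catP A B (f : A -> B) (D : forest A) F G :
  fmap f D = fcat F G ->
  exists D1 D2, [/\ D = fcat D1 D2, fmap f D1 = F & fmap f D2 = G].
Proof.
elim: F D => [|a ch _ sib IH] D /=; first by exists Nil, D.
case: D => //= b dch dsib [h1 h2 /IH [D1 [D2 [-> <- <-]]]].
by exists (Cons b dch D1), D2; rewrite /= h1 h2.
Qed.

Local Open Scope Z_scope.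
Local Arguments Z.add : simpl never.
Local Arguments Z.sub : simpl never.
Local Arguments Z.opp : simpl never.
Local Arguments Z.mul : simpl never.

Fixpoint fsz A (F : forest A) : Z :=
  if F is Cons _ ch sib then 1 + fsz ch + fsz sib else 0.

Lemma fsz_ge0 A (F : forest A) : 0 <= fsz F.
Proof. elim: F => [|a ch h1 sib h2] /=; lia. Qed.

Arguments fsz_ge0 {A} F.

Lemma fsz_cat A (F G : forest A) : fsz (fcat F G) = fsz F + fsz G.
Proof. elim: F => [|a ch _ sib IH] //=; lia. Qed.

Lemma fsz_labels A (F : forest A) : fsz F = Z.of_nat (size (labels F)).
Proof. elim: F => //= a ch -> sib ->; rewrite size_cat -plusE; lia. Qed.

Lemma fsz_perm (T : eqType) (F G : forest T) :
  perm_eq (labels F) (labels G) -> fsz F = fsz G.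
Proof. by move/perm_size; rewrite !fsz_labels => ->. Qed.

(** * Plane vectors *)

Definition dot (d x : point) : Z := fst d * fst x + snd d * snd x.
Definition cross (x y : point) : Z := fst x * snd y - snd x * fst y.
Definition vadd (x y : point) : point := (fst x + fst y, snd x + snd y).
Definition vopp (x : point) : point := (- fst x, - snd x).

Lemma dot_vadd d x y : dot d (vadd x y) = dot d x + dot d y.
Proof. rewrite /dot /=; ring. Qed.

Lemma dot_vopp d x : dot (vopp d) x = - dot d x.
Proof. rewrite /dot /=; ring. Qed.

Lemma cross_vaddr x y z : cross x (vadd y z) = cross x y + cross x z.
Proof. rewrite /cross /=; ring. Qed.

Lemma cross_vaddl x y z : cross (vadd x y) z = cross x z + cross y z.
Proof. rewrite /cross /=; ring. Qed.

Lemma crossxx x : cross x x = 0.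
Proof. rewrite /cross; ring. Qed.

Lemma crossC x y : cross x y = - cross y x.
Proof. rewrite /cross; ring. Qed.

(* Nodes of a drawn forest carry the vector from the parent to the node. *)
Fixpoint vin A (x : point) (D : forest (A * point)) : Prop :=
  if D is Cons a ch sib then [\/ x = snd a, vin x ch | vin x sib] else False.

Lemma vin_cat A x (D E : forest (A * point)) :
  vin x (fcat D E) <-> vin x D \/ vin x E.
Proof.
elim: D => [|a ch _ sib IH] /=; first by tauto.
split=> [[h|h|/IH [h|h]] | [[h|h|h]|h]].
- by left; constructor 1.
- by left; constructor 2.
- by left; constructor 3.
- by right.
- by constructor 1.
- by constructor 2.
- by constructor 3; apply/IH; left.
- by constructor 3; apply/IH; right.
Qed.

(** Siblings are listed counterclockwise, and directions used in different sibling subtrees do not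
    interleave. Being pairwise, the condition passes through [fcat]; [good_mono] turns it into
    separating lines. *)
Fixpoint good A (D : forest (A * point)) : Prop :=
  if D is Cons a ch sib then
    [/\ forall x y, x = snd a \/ vin x ch -> vin y sib -> 0 < cross x y,
        good ch & good sib]
  else True.

Lemma good_cat A (D E : forest (A * point)) :
  good (fcat D E) <->
  [/\ good D, good E & forall x y, vin x D -> vin y E -> 0 < cross x y].
Proof.
elim: D => [|a ch _ sib IH] /=; first by split=> [|[]] //; split.
split.
- case=> h1 h2 /IH [h3 h4 h5]; split=> //.
    by split=> // x y hx hy; apply: h1 => //; apply/vin_cat; left.
  by move=> x y [hx|hx|hx] hy; [apply: h1 | apply: h1 | exact: h5];
     rewrite ?vin_cat; tauto.
- case=> [[h1 h2 h3] h4 h5]; split=> //; last first.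
    by apply/IH; split=> // x y hx; apply: h5; constructor 3.
  move=> x y hx /vin_cat [hy|hy]; first exact: h1.
  by apply: h5 => //; case: hx => ?; [constructor 1 | constructor 2].
Qed.

(* Every node lies at level at most [W] above the common parent of the roots. *)
Fixpoint bnd A (f : point) (W : Z) (D : forest (A * point)) : Prop :=
  if D is Cons a ch sib then
    [/\ dot f (snd a) <= W, bnd f (W - dot f (snd a)) ch & bnd f W sib]
  else True.

Lemma bnd_le A f W W' (D : forest (A * point)) : W <= W' -> bnd f W D -> bnd f W' D.
Proof.
elim: D W W' => [|a ch IH1 sib IH2] W W' //= hW [h1 h2 h3]; split; first lia.
- by apply: IH1 h2; lia.
- exact: IH2 h3.
Qed.

Lemma bnd_cat A f W (D E : forest (A * point)) :
  bnd f W (fcat D E) <-> bnd f W D /\ bnd f W E.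
Proof.
elim: D => [|a ch _ sib IH] /=; first by split=> [|[]].
split=> [[h1 h2 /IH [h3 h4]] | [[h1 h2 h3] h4]]; first by [].
by split=> //; apply/IH.
Qed.

Lemma bnd_domin A f g W (D : forest (A * point)) :
  (forall x, vin x D -> dot f x <= dot g x) -> bnd g W D -> bnd f W D.
Proof.
elim: D W => [|a ch IH1 sib IH2] W //= h [h1 h2 h3].
have ha : dot f (snd a) <= dot g (snd a) by apply: h; constructor 1.
split; first lia.
- apply: (@bnd_le _ _ (W - dot g (snd a))); first lia.
  by apply: IH1 h2 => x hx; apply: h; constructor 2.
- by apply: IH2 h3 => x hx; apply: h; constructor 3.
Qed.

Lemma bnd_nonpos A f W (D : forest (A * point)) :
  0 <= W -> (forall x, vin x D -> dot f x <= 0) -> bnd f W D.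
Proof.
elim: D W => [|a ch IH1 sib IH2] W //= hW h.
have ha : dot f (snd a) <= 0 by apply: h; constructor 1.
split; first lia.
- by apply: IH1 => [|x hx]; [lia | apply: h; constructor 2].
- by apply: IH2 => // x hx; apply: h; constructor 3.
Qed.

(** * Separation of siblings and monotone paths *)

(** [d] separates a subtree, its root edge included, from all later siblings at once; a path from
    the former through the parent into the latter then increases along [d]. *)
Fixpoint mono A (D : forest (A * point)) : Prop :=
  if D is Cons a ch sib then
    [/\ exists d, (forall x, x = snd a \/ vin x ch -> dot d x < 0) /\
                  (forall y, vin y sib -> 0 < dot d y),
        mono ch & mono sib]
  else True.

(** In the open half-plane of [h] a nonnegative [cross] compares angles. Transitivity follows from
    the three-term identity [E], whose coefficients are positive there. *)
Lemma cross_ge0_trans h x y z : 0 < dot h x -> 0 < dot h y -> 0 < dot h z ->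
  0 <= cross x y -> 0 <= cross y z -> 0 <= cross x z.
Proof.
move=> hx hy hz hxy hyz.
have E : dot h y * cross x z = dot h z * cross x y + dot h x * cross y z.
  rewrite /dot /cross; ring.
nia.
Qed.

(** The relation is abstract so that it can be the angle order (last vector of a subtree) or its
    reverse (first vector of the later siblings). *)
Lemma forest_max A (R : point -> point -> Prop) (P : point -> Prop)
    (D : forest (A * point)) (m : point) :
  (forall x y, P x -> P y -> R x y \/ R y x) ->
  (forall x y z, P x -> P y -> P z -> R x y -> R y z -> R x z) ->
  P m -> (forall x, vin x D -> P x) ->
  exists k, [/\ k = m \/ vin k D, R m k & forall x, vin x D -> R x k].
Proof.
move=> tot tr; elim: D m => [|a ch IH1 sib IH2] m Pm /= h.
  by exists m; split=> //; [left | case: (tot m m Pm Pm)].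
have Pa : P (snd a) by apply: h; constructor 1.
have [n [Pn nE Rm Ra]] : exists n, [/\ P n, n = m \/ n = snd a, R m n & R (snd a) n].
  case: (tot m (snd a) Pm Pa) => hR.
    by exists (snd a); split=> //; [right | case: (tot _ _ Pa Pa)].
  by exists m; split=> //; [left | case: (tot _ _ Pm Pm)].
have [k [kE Rk hk]] := IH1 n Pn (fun x hx => h x (Or32 _ _ hx)).
have Pk : P k by case: kE => [->|hx] //; apply: h; constructor 2.
have [l [lE Rl hl]] := IH2 k Pk (fun x hx => h x (Or33 _ _ hx)).
have Pl : P l by case: lE => [->|hx] //; apply: h; constructor 3.
exists l; split.
- case: lE => [->|?]; last by right; constructor 3.
  case: kE => [->|?]; last by right; constructor 2.
  by case: nE => ->; [left | right; constructor 1].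
- exact: tr (tr _ _ _ _ _ _ Rm Rk) Rl.
- move=> x [->|hx|hx]; last exact: hl.
    exact: tr (tr _ _ _ _ _ _ Ra Rk) Rl.
  by apply: tr (hk x hx) Rl => //; apply: h; constructor 2.
Qed.

Lemma good_mono A h (D : forest (A * point)) :
  (forall x, vin x D -> 0 < dot h x) -> good D -> mono D.
Proof.
elim: D => [|a ch IH1 sib IH2] //= hD [h1 h2 h3]; split; last first.
- by apply: IH2 => // x hx; apply: hD; constructor 3.
- by apply: IH1 => // x hx; apply: hD; constructor 2.
case: sib IH2 hD h1 h3 => [|b bch bsib] _ hD h1 _.
  exists (vopp h); split=> // x hx; rewrite dot_vopp.
  suff : 0 < dot h x by lia.
  by apply: hD; case: hx => ?; [constructor 1 | constructor 2].
set S := Cons b bch bsib in hD h1 *.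
have Pa : 0 < dot h (snd a) by apply: hD; constructor 1.
have hS x : vin x S -> 0 < dot h x by move=> hx; apply: hD; constructor 3.
have hC x : vin x ch -> 0 < dot h x by move=> hx; apply: hD; constructor 2.
have [k [kE Rk hk]] := @forest_max _ (fun x y => 0 <= cross x y) (fun x => 0 < dot h x) ch (snd a)
   ltac:(by move=> x y _ _ /=; have := crossC x y; lia)
   ltac:(by move=> x y z ? ? ?; apply: (@cross_ge0_trans h)) Pa hC.
have bS : vin (snd b) S by constructor 1.
have [l [lE Rl hl]] := @forest_max _ (fun x y => 0 <= cross y x) (fun x => 0 < dot h x) S (snd b)
   ltac:(by move=> x y _ _ /=; have := crossC x y; lia)
   ltac:(by move=> x y z ? ? ? ? ?; apply: (@cross_ge0_trans h z y x)) (hS _ bS) hS.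
have lS : vin l S by case: lE => [->|].
(* Counterclockwise, [k] is the last vector of the subtree and [l] the first of the siblings, so the
   line spanned by [k + l] separates them; the witness is [k + l] turned by a right angle. *)
exists (- (snd k + snd l), fst k + fst l).
have dE x : dot (- (snd k + snd l), fst k + fst l) x = cross k x + cross l x.
  rewrite /dot /cross /=; ring.
split=> [x hx | y hy]; rewrite dE.
- have := h1 x l hx lS; have : 0 <= cross x k by case: hx => [->|/hk].
  rewrite (crossC k) (crossC l); lia.
- have := h1 k y kE hy; have := hl y hy; lia.
Qed.

Section MonotonePaths.
Variables (T : eqType) (e : rel T) (pos : T -> point).
Hypothesis e_sym : symmetric e.

Fixpoint fits (r : T) (D : forest (T * point)) : Prop :=
  if D is Cons a ch sib then
    [/\ pos (fst a) = vadd (pos r) (snd a), fits (fst a) ch & fits r sib]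
  else True.

(** With an integral direction and a Boolean test, monotone paths become ordinary [path]s of a
    relation. *)
Definition stepd (d : point) : rel T := fun a b =>
  e a b && (0 <? dot d (vadd (pos b) (vopp (pos a)))).

Definition mconn (u v : T) : Prop :=
  exists d p, path (stepd d) u p /\ last u p = v.

Lemma stepd_down d a b x : e a b -> pos b = vadd (pos a) x -> 0 < dot d x ->
  stepd d a b.
Proof.
rewrite /stepd => -> -> hx /=; apply/Z.ltb_lt; move: hx; rewrite /dot /=; nia.
Qed.

Lemma stepd_up d a b x : e a b -> pos b = vadd (pos a) x -> dot d x < 0 ->
  stepd d b a.
Proof.
rewrite /stepd e_sym => -> -> hx /=; apply/Z.ltb_lt; move: hx; rewrite /dot /=; nia.
Qed.

Lemma forest_down d r D b : adj e r (erase D) -> fits r D ->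
  (forall x, vin x D -> 0 < dot d x) -> b \in r :: labels (erase D) ->
  exists p, path (stepd d) r p /\ last r p = b.
Proof.
elim: D r => [|a ch IH1 sib IH2] r /=.
  by move=> _ _ _; rewrite inE => /eqP ->; exists [::].
move=> [h1 h2 h3] [g1 g2 g3] hd hb.
have [hb'|hb'] : b \in fst a :: labels (erase ch) \/ b \in r :: labels (erase sib).
- by move: hb; rewrite !inE mem_cat => /or4P [] h;
    [right | left | left | right]; rewrite ?in_cons h ?orbT.
- have [|p [hp lp]] := IH1 _ h2 g2 _ hb'; first by move=> x hx; apply: hd; constructor 2.
  exists (fst a :: p); split=> //=; rewrite hp andbT.
  by apply: stepd_down g1 _ => //; apply: hd; constructor 1.
- by apply: (IH2 _ h3 g3 _ hb') => x hx; apply: hd; constructor 3.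
Qed.

Lemma forest_up d r D b : adj e r (erase D) -> fits r D ->
  (forall x, vin x D -> dot d x < 0) -> b \in r :: labels (erase D) ->
  exists p, path (stepd d) b p /\ last b p = r.
Proof.
elim: D r => [|a ch IH1 sib IH2] r /=.
  by move=> _ _ _; rewrite inE => /eqP ->; exists [::].
move=> [h1 h2 h3] [g1 g2 g3] hd hb.
have [hb'|hb'] : b \in fst a :: labels (erase ch) \/ b \in r :: labels (erase sib).
- by move: hb; rewrite !inE mem_cat => /or4P [] h;
    [right | left | left | right]; rewrite ?in_cons h ?orbT.
- have [|p [hp lp]] := IH1 _ h2 g2 _ hb'; first by move=> x hx; apply: hd; constructor 2.
  exists (rcons p r); rewrite last_rcons rcons_path hp lp; split=> //=.
  by apply: stepd_up g1 _ => //; apply: hd; constructor 1.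
- by apply: (IH2 _ h3 g3 _ hb') => x hx; apply: hd; constructor 3.
Qed.

(** The path climbs from [u] to [r] against edges that are negative for [d], then descends to [v]
    along positive ones, so it increases throughout. For the way back the direction is [vopp d]. *)
Lemma separated_mconn d r D E u v :
  adj e r (erase D) -> adj e r (erase E) -> fits r D -> fits r E ->
  (forall x, vin x D -> dot d x < 0) -> (forall x, vin x E -> 0 < dot d x) ->
  u \in r :: labels (erase D) -> v \in r :: labels (erase E) ->
  mconn u v /\ mconn v u.
Proof.
move=> aD aE fD fE hD hE hu hv; split.
- have [p [hp lp]] := forest_up aD fD hD hu.
  have [q [hq lq]] := forest_down aE fE hE hv.
  by exists d, (p ++ q); rewrite cat_path last_cat hp lp hq lq.
- have [|p [hp lp]] := @forest_up (vopp d) _ _ _ aE fE _ hv.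
    by move=> x /hE; rewrite dot_vopp; lia.
  have [|q [hq lq]] := @forest_down (vopp d) _ _ _ aD fD _ hu.
    by move=> x /hD; rewrite dot_vopp; lia.
  by exists (vopp d), (p ++ q); rewrite cat_path last_cat hp lp hq lq.
Qed.

Lemma mono_mconn r D u v : adj e r (erase D) -> fits r D -> mono D ->
  u \in r :: labels (erase D) -> v \in r :: labels (erase D) -> mconn u v.
Proof.
elim: D r => [|a ch IH1 sib IH2] r /=.
  by move=> _ _ _; rewrite !inE => /eqP -> /eqP ->; exists (0,0), [::].
move=> [h1 h2 h3] [g1 g2 g3] [[d [d1 d2]] m1 m2].
have split_mem b : b \in r :: fst a :: labels (erase ch) ++ labels (erase sib) ->
    b \in fst a :: labels (erase ch) \/ b \in r :: labels (erase sib).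
  by rewrite !inE mem_cat => /or4P [] h; [right | left | left | right]; rewrite ?in_cons h ?orbT.
have sep u' v' : u' \in fst a :: labels (erase ch) ->
    v' \in r :: labels (erase sib) -> mconn u' v' /\ mconn v' u'.
  move=> hu hv; apply: (@separated_mconn d r (Cons a ch Nil) sib) => //=.
    by move=> x [->|?|//]; apply: d1; [left | right].
  by rewrite cats0 in_cons hu orbT.
move=> /split_mem [hu|hu] /split_mem [hv|hv].
- exact: (IH1 (fst a)).
- by case: (sep u v).
- by case: (sep v u).
- exact: (IH2 r).
Qed.

End MonotonePaths.

Lemma fits_eq (T : eqType) (f g : T -> point) r D :
  {in r :: labels (erase D), f =1 g} -> fits f r D -> fits g r D.
Proof.
elim: D r => [|a ch IH1 sib IH2] r //= h [h1 h2 h3].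
have er := h r (mem_head _ _).
have ea : f (fst a) = g (fst a) by apply: h; rewrite !inE eqxx orbT.
split; first by rewrite -ea h1 er.
- by apply: IH1 h2 => x hx; apply: h; rewrite -cat_cons in_cons mem_cat hx orbT.
- apply: IH2 h3 => x; rewrite in_cons => /orP [/eqP -> //|hx].
  by apply: h; rewrite !inE mem_cat hx !orbT.
Qed.

(** Positions are propagated from the root. Since labels are distinct, the assignments for the first
    tree and for its siblings can be glued. *)
Lemma fits_exists (T : eqType) r (D : forest (T * point)) (o : point) :
  uniq (r :: labels (erase D)) -> exists pos, pos r = o /\ fits pos r D.
Proof.
elim: D r o => [|a ch IH1 sib IH2] r o; first by move=> _; exists (fun=> o).
move=> /= /andP [rn /andP [an]]; rewrite cat_uniq => /and3P [uc hs us].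
move: rn an; rewrite inE !mem_cat !negb_or => /and3P [ra rc rs] /andP [ac as_].
have [|f [fa hf]] := IH1 (fst a) (vadd o (snd a)); first by rewrite /= ac.
have [|g [gr hg]] := IH2 r o; first by rewrite /= rs.
exists (fun t => if t \in fst a :: labels (erase ch) then f t else g t).
have rE : (r \in fst a :: labels (erase ch)) = false.
  by rewrite inE (negbTE ra) (negbTE rc).
split; first by rewrite rE.
split; first by rewrite mem_head rE fa gr.
- by apply: fits_eq hf => t ht; rewrite ht.
- apply: fits_eq hg => t; rewrite in_cons => /orP [/eqP -> |ht]; first by rewrite rE.
  suff -> : (t \in fst a :: labels (erase ch)) = false by [].
  apply/negbTE; rewrite inE negb_or; apply/andP; split.
    by apply: contraNneq as_ => <-.
  by apply: contra hs => hc; apply/hasP; exists t.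
Qed.

Lemma fits_bnd (T : eqType) (pos : T -> point) f W r D t :
  fits pos r D -> bnd f W D -> t \in labels (erase D) ->
  dot f (pos t) <= dot f (pos r) + W.
Proof.
elim: D r W => [|a ch IH1 sib IH2] r W //= [h1 h2 h3] [b1 b2 b3].
have E : dot f (pos (fst a)) = dot f (pos r) + dot f (snd a) by rewrite h1 dot_vadd.
rewrite inE mem_cat => /or3P [/eqP ->|ht|ht].
- by rewrite E; lia.
- by have := IH1 _ _ h2 b2 ht; lia.
- exact: IH2 h3 b3 ht.
Qed.

(** * Combs *)

(* A stem (the nodes [a] of the [CStem]s) running down from the common parent,
   with forests hanging off its vertices on either side. *)
Inductive comb (A : Type) : Type :=
| CNil
| CLeft (G : forest A) (C : comb A)
| CRight (C : comb A) (G : forest A)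
| CStem (a : A) (C : comb A).

Arguments CNil {A}.

Fixpoint cforest A (C : comb A) : forest A :=
  match C with
  | CNil => Nil
  | CLeft G C => fcat G (cforest C)
  | CRight C G => fcat (cforest C) G
  | CStem a C => Cons a (cforest C) Nil
  end.

Fixpoint cleft A (C : comb A) : forest A :=
  match C with
  | CNil => Nil
  | CLeft G C => fcat G (cleft C)
  | CRight C G => cleft C
  | CStem a C => cleft C
  end.

Fixpoint cright A (C : comb A) : forest A :=
  match C with
  | CNil => Nil
  | CLeft G C => cright C
  | CRight C G => fcat (cright C) G
  | CStem a C => cright C
  end.

Fixpoint cstem A (C : comb A) : Z :=
  match C with
  | CNil => 0
  | CLeft _ C | CRight C _ => cstem C
  | CStem _ C => 1 + cstem C
  end.

(* If the left forests fit in height [bl], the right ones in height [br] and a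
   stem edge has height [c], then the whole comb fits in height [W]. *)
Fixpoint budget A (bl br c W : Z) (C : comb A) : Prop :=
  match C with
  | CNil => True
  | CLeft _ C => bl <= W /\ budget bl br c W C
  | CRight C _ => br <= W /\ budget bl br c W C
  | CStem _ C => c <= W /\ budget bl br c (W - c) C
  end.

Lemma comb_size A (C : comb A) :
  fsz (cforest C) = cstem C + fsz (cleft C) + fsz (cright C).
Proof. elim: C => [|G C IH|C IH G|a C IH] //=; rewrite ?fsz_cat; lia. Qed.

Lemma cstem_ge0 A (C : comb A) : 0 <= cstem C.
Proof. elim: C => [|G C IH|C IH G|a C IH] //=; lia. Qed.

Arguments cstem_ge0 {A} C.

(** The worst case is a forest at the bottom of the stem, where all [cstem C] edges have used up
    their height. *)
Lemma budget_stem A (bl br c W H : Z) (C : comb A) : 0 <= c -> 0 <= H ->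
  bl <= H -> br <= H -> c * cstem C + H <= W -> budget bl br c W C.
Proof.
move=> hc hH hl hr.
elim: C W => [|G C IH|C IH G|a C IH] W //= hW;
  have hs := cstem_ge0 C; split; try apply: IH; nia.
Qed.

(** All stem edges get the same vector [w], with the left forests clockwise of it and the right ones
    counterclockwise. The bound is quantified over [f] so that one drawing can be measured in
    several directions. *)
Lemma comb_draw A (w : point) (C : comb A) (X Y : forest (A * point)) :
  erase X = cleft C -> erase Y = cright C -> good X -> good Y ->
  (forall x, vin x X -> 0 < cross x w) -> (forall y, vin y Y -> 0 < cross w y) ->
  (forall x y, vin x X -> vin y Y -> 0 < cross x y) ->
  exists D, [/\ erase D = cforest C, good D,
    forall x, vin x D -> [\/ vin x X, x = w | vin x Y] &
    forall f bl br W, bnd f bl X -> bnd f br Y -> budget bl br (dot f w) W C ->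
      bnd f W D].
Proof.
elim: C X Y => [|G C IH|C IH G|a C IH] X Y /=.
- by move=> _ _ _ _ _ _ _; exists Nil.
- move=> /fmap_catP [X1 [X2 [-> eG eX]]] eY /good_cat [g1 g2 g12] gY hX hY hXY.
  have [|||D [eD gD vD bD]] := IH X2 Y eX eY g2 gY.
  + by move=> x hx; apply: hX; apply/vin_cat; right.
  + exact: hY.
  + by move=> x y hx; apply: hXY; apply/vin_cat; right.
  exists (fcat X1 D); split.
  + by rewrite fmap_cat eD eG.
  + apply/good_cat; split=> // x y hx /vD [hy|->|hy]; first exact: g12.
      by apply: hX; apply/vin_cat; left.
    by apply: hXY => //; apply/vin_cat; left.
  + move=> x /vin_cat [hx|/vD [hx|hx|hx]];
      [constructor 1 | constructor 1 | constructor 2 | constructor 3] => //;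
      apply/vin_cat; tauto.
  + move=> f bl br W /bnd_cat [b1 b2] bY [hl hb]; apply/bnd_cat; split.
      exact: bnd_le b1.
    exact: bD b2 bY hb.
- move=> eX /fmap_catP [Y1 [Y2 [-> eY eG]]] gX /good_cat [g1 g2 g12] hX hY hXY.
  have [|||D [eD gD vD bD]] := IH X Y1 eX eY gX g1.
  + exact: hX.
  + by move=> x hx; apply: hY; apply/vin_cat; left.
  + by move=> x y hx hy; apply: hXY => //; apply/vin_cat; left.
  exists (fcat D Y2); split.
  + by rewrite fmap_cat eD eG.
  + apply/good_cat; split=> // x y /vD [hx|->|hx] hy; last exact: g12.
      by apply: hXY => //; apply/vin_cat; right.
    by apply: hY; apply/vin_cat; right.
  + move=> x /vin_cat [/vD [hx|hx|hx]|hx];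
      [constructor 1 | constructor 2 | constructor 3 | constructor 3] => //;
      apply/vin_cat; tauto.
  + move=> f bl br W bX /bnd_cat [b1 b2] [hr hb]; apply/bnd_cat; split.
      exact: bD bX b1 hb.
    exact: bnd_le b2.
- move=> eX eY gX gY hX hY hXY.
  have [D [eD gD vD bD]] := IH X Y eX eY gX gY hX hY hXY.
  exists (Cons (a, w) D Nil); split=> /=.
  + by rewrite eD.
  + by split.
  + by move=> x [->|/vD|//]; first by constructor 2.
  + by move=> f bl br W bX bY [hc hb]; split=> //; apply: bD bX bY hb.
Qed.

(* The stem enters the tree in which the left capacity [W / l] is exceeded;
   [l * k <= c * (l + k)] then leaves room for all later trees on the right. *)
Lemma comb_split A (c l k : Z) (F : forest A) (p q W : Z) :
  0 < c -> 0 < l -> 0 < k -> l * k <= c * (l + k) -> 0 <= p -> 0 <= q ->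
  c * (p + fsz F + q) <= W ->
  exists C, let bl := l * (p + fsz (cleft C)) in
            let br := k * (q + fsz (cright C)) in
    [/\ cforest C = F, budget bl br c W C,
        fsz (cleft C) = 0 \/ bl <= W & fsz (cright C) = 0 \/ br <= W].
Proof.
move=> hc hl hk hlk; elim: F p q W => [|a ch IH1 sib IH2] p q W hp hq hW.
  by exists CNil; split=> //=; left.
have hch := fsz_ge0 ch; have hsib := fsz_ge0 sib; rewrite /= in hW.
(* [p] and [q] count the nodes already placed left and right. As long as the first tree fits on the
   left, it is hung there. *)
case: (Z_le_gt_dec (l * (p + (1 + fsz ch))) W) => hcase.
- have [|||C [eC bC lC rC]] := IH2 (p + (1 + fsz ch)) q W; try nia.
  exists (CLeft (Cons a ch Nil) C) => /=.
  have -> : l * (p + (1 + fsz ch + fsz (cleft C)))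
          = l * (p + (1 + fsz ch) + fsz (cleft C)) by ring.
  have hb : l * (p + (1 + fsz ch) + fsz (cleft C)) <= W.
    by case: lC => [->|] //; rewrite Z.add_0_r.
  by split; rewrite ?eC //; right.
(* The left side would overflow with [u] nodes. If the right side overflowed with [v] nodes too,
   weighting the two inequalities by [k] and [l] would contradict [l * k <= c * (l + k)]. *)
- have hr : k * (q + fsz sib) <= W.
    case: (Z_le_gt_dec (k * (q + fsz sib)) W) => // hgt.
    set u := p + (1 + fsz ch) in hcase; set v := q + fsz sib in hgt *.
    have hW' : c * (u + v) <= W by rewrite /u /v; lia.
    have hu : 0 < u by rewrite /u; lia.
    have h1 : W * (l + k) < l * k * (u + v) by nia.
    have h2 : l * k * (u + v) <= c * (l + k) * (u + v).
      by apply: Z.mul_le_mono_nonneg_r => //; rewrite /v; lia.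
    have h3 : c * (l + k) * (u + v) <= W * (l + k) by nia.
    lia.
  have [|||C [eC bC lC rC]] := IH1 p (q + fsz sib) (W - c); try nia.
  exists (CRight (CStem a C) sib) => /=.
  have -> : fsz (fcat (cright C) sib) = fsz sib + fsz (cright C).
    by rewrite fsz_cat; ring.
  have -> : k * (q + (fsz sib + fsz (cright C)))
          = k * (q + fsz sib + fsz (cright C)) by ring.
  have hb : k * (q + fsz sib + fsz (cright C)) <= W.
    by case: rC => [->|] //; rewrite ?Z.add_0_r //; lia.
  split; first by rewrite eC.
  + by split=> //; split=> //; nia.
  + by case: lC => ?; [left | right; lia].
  + by right.
Qed.

(** * Drawing forests in open cones *)

(** Coefficients are at least [1], which keeps vectors off the boundary rays; the halves cut off by
    [vadd a b] are cones of the same form inside this one. *)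
Definition incone (a b x : point) : Prop :=
  exists i j, [/\ 1 <= i, 1 <= j &
    x = (i * fst a + j * fst b, i * snd a + j * snd b)].

Lemma incone_left a b x : incone a (vadd a b) x -> incone a b x.
Proof.
move=> [i [j [hi hj ->]]]; exists (i + j), j; split; try lia.
by rewrite /=; congr pair; ring.
Qed.

Lemma incone_right a b x : incone (vadd a b) b x -> incone a b x.
Proof.
move=> [i [j [hi hj ->]]]; exists i, (i + j); split; try lia.
by rewrite /=; congr pair; ring.
Qed.

Lemma incone_mid a b : incone a b (vadd a b).
Proof. by exists 1, 1; split=> //; rewrite /vadd; congr pair; ring. Qed.

Lemma cross_left a b x : 0 < cross a b -> incone a (vadd a b) x ->
  0 < cross x (vadd a b).
Proof.
move=> hab [i [j [hi hj ->]]].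
have -> : cross (i * fst a + j * fst (vadd a b), i * snd a + j * snd (vadd a b))
                (vadd a b) = i * cross a b by rewrite /cross /=; ring.
nia.
Qed.

Lemma cross_right a b y : 0 < cross a b -> incone (vadd a b) b y ->
  0 < cross (vadd a b) y.
Proof.
move=> hab [i [j [hi hj ->]]].
have -> : cross (vadd a b) (i * fst (vadd a b) + j * fst b, i * snd (vadd a b) + j * snd b)
          = j * cross a b by rewrite /cross /=; ring.
nia.
Qed.

Lemma cross_left_right a b x y : 0 < cross a b ->
  incone a (vadd a b) x -> incone (vadd a b) b y -> 0 < cross x y.
Proof.
move=> hab [i [j [hi hj ->]]] [i' [j' [hi' hj' ->]]].
set s := cross _ _.
have -> : s = (i * i' + i * j' + j * j') * cross a b by rewrite /s /cross /=; ring.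
nia.
Qed.

Lemma comb_draw_cone A a b (C : comb A) (X Y : forest (A * point)) :
  0 < cross a b -> erase X = cleft C -> erase Y = cright C -> good X -> good Y ->
  (forall x, vin x X -> incone a (vadd a b) x) ->
  (forall y, vin y Y -> incone (vadd a b) b y) ->
  exists D, [/\ erase D = cforest C, good D, forall x, vin x D -> incone a b x &
    forall f bl br W, bnd f bl X -> bnd f br Y ->
      budget bl br (dot f (vadd a b)) W C -> bnd f W D].
Proof.
move=> hab eX eY gX gY hX hY.
have [||| D [eD gD vD bD]] := @comb_draw _ (vadd a b) _ _ _ eX eY gX gY.
- by move=> x /hX; apply: cross_left.
- by move=> y /hY; apply: cross_right.
- by move=> x y /hX hx /hY; apply: cross_left_right hx.
exists D; split=> // x /vD [/hX|->|/hY].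
- exact: incone_left.
- exact: incone_mid.
- exact: incone_right.
Qed.

Lemma cone_draw A (F : forest A) (a b f : point) :
  0 < cross a b -> 1 <= dot f a -> 1 <= dot f b ->
  exists D, [/\ erase D = F, good D, forall x, vin x D -> incone a b x &
    bnd f ((dot f a + dot f b) * fsz F) D].
Proof.
have [n hn] : exists n, fsz F <= Z.of_nat n by exists (Z.to_nat (fsz F)); lia.
elim: n F hn a b => [|n IH] F hn a b hab ha hb.
  by case: F hn => [|x ch sib] /=; [exists Nil | have := fsz_ge0 ch; have := fsz_ge0 sib; lia].
case: F hn => [|x ch sib] hn; first by exists Nil.
set F := Cons x ch sib in hn *.
have hF : 0 < fsz F by rewrite /=; have := fsz_ge0 ch; have := fsz_ge0 sib; lia.
move: F hF hn => F hF hn {x ch sib}.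
set p := dot f b; set q := dot f a.
(* A stem edge has height [p + q]; the heights per node in the two halves of the cone are
   [p + 2 * q] and [2 * p + q]. The hypothesis of [comb_split] reads [(p + 2 * q) * (2 * p + q) <= 3
   * (p + q) ^ 2]. *)
have [||||||| C] := @comb_split A (p + q) (p + 2 * q) (2 * p + q) F 0 0 ((p + q) * fsz F);
  try by rewrite /p /q; nia.
move=> /= [eC bC lC rC]; rewrite !Z.add_0_l in bC lC rC.
have hab1 : 0 < cross a (vadd a b) by rewrite cross_vaddr crossxx.
have hab2 : 0 < cross (vadd a b) b by rewrite cross_vaddl crossxx; lia.
have hc : dot f (vadd a b) = q + p by rewrite dot_vadd.
have [||X [eX gX hX bX]] := IH (cleft C) _ a (vadd a b) hab1 ha.
(* The induction advances because [p + 2 * q] exceeds [p + q]: the left part is strictly smaller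
   than [F]. *)
- by have := fsz_ge0 (cleft C); rewrite /p /q in lC; case: lC; nia.
- by rewrite hc /q /p; lia.
have [||Y [eY gY hY bY]] := IH (cright C) _ (vadd a b) b hab2 _ hb.
- by have := fsz_ge0 (cright C); rewrite /p /q in rC; case: rC; nia.
- by rewrite hc /q /p; lia.
have [D [eD gD vD bD]] := comb_draw_cone hab eX eY gX gY hX hY.
exists D; split=> //; first by rewrite eD.
apply: bD bX bY _; rewrite hc -/p -/q.
have -> : (q + (q + p)) * fsz (cleft C) = (p + 2 * q) * fsz (cleft C) by ring.
have -> : (q + p + p) * fsz (cright C) = (2 * p + q) * fsz (cright C) by ring.
by rewrite (Z.add_comm q p).
Qed.

(** A diagonal stem edge costs [1] in both directions, and each half of the quadrant costs [2] per
    node. Next to [a] the form [f] dominates [g], next to [b] it is the reverse, so one bound from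
    [cone_draw] per half controls both. *)
Lemma quadrant_draw A (F : forest A) (a b f g : point) : 0 < cross a b ->
  dot f a = 1 -> dot f b = 0 -> dot g a = 0 -> dot g b = 1 ->
  exists D, [/\ erase D = F, good D, forall x, vin x D -> incone a b x,
    bnd f (fsz F) D & bnd g (fsz F) D].
Proof.
move=> hab fa fb ga gb.
have [||||||| C] := @comb_split A 1 2 2 F 0 0 (fsz F); try lia.
move=> /= [eC bC lC rC]; rewrite !Z.add_0_l in bC lC rC.
have hab1 : 0 < cross a (vadd a b) by rewrite cross_vaddr crossxx.
have hab2 : 0 < cross (vadd a b) b by rewrite cross_vaddl crossxx; lia.
have [||X [eX gX hX bX]] := @cone_draw _ (cleft C) a (vadd a b) f hab1;
  rewrite ?dot_vadd; try lia.
have [||Y [eY gY hY bY]] := @cone_draw _ (cright C) (vadd a b) b g hab2;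
  rewrite ?dot_vadd; try lia.
have [D [eD gD vD bD]] := comb_draw_cone hab eX eY gX gY hX hY.
rewrite !dot_vadd fa fb ga gb in bX bY bD.
have lin h i j u v :
    dot h (i * fst u + j * fst v, i * snd u + j * snd v) = i * dot h u + j * dot h v.
  by rewrite /dot /=; ring.
have bX' : bnd g (2 * fsz (cleft C)) X.
  apply: bnd_domin bX => x /hX [i [j [hi hj ->]]].
  by rewrite !lin !dot_vadd fa fb ga gb; lia.
have bY' : bnd f (2 * fsz (cright C)) Y.
  apply: bnd_domin bY => x /hY [i [j [hi hj ->]]].
  by rewrite !lin !dot_vadd fa fb ga gb; lia.
exists D; split=> //; first by rewrite eD.
- by apply: (bD f _ _ _ bX bY'); rewrite dot_vadd fa fb.
- by apply: (bD g _ _ _ bX' bY); rewrite dot_vadd ga gb.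
Qed.

(** * Balanced combs *)

(** Stands for reordering siblings; it keeps only what the drawing needs. Quantifying over all [e]
    and [r] makes it stable under concatenation and under adding a parent. *)
Definition resib (T : eqType) (F G : forest T) : Prop :=
  perm_eq (labels F) (labels G) /\ forall e r, adj e r F -> adj e r G.

Lemma resib_refl (T : eqType) (F : forest T) : resib F F.
Proof. by []. Qed.

Lemma resib_trans (T : eqType) (F G H : forest T) :
  resib F G -> resib G H -> resib F H.
Proof.
by move=> [p1 a1] [p2 a2]; split=> [|e r /a1 /a2 //]; apply: perm_trans p1 p2.
Qed.

Lemma resib_cat (T : eqType) (F F' G G' : forest T) :
  resib F F' -> resib G G' -> resib (fcat F G) (fcat F' G').
Proof.
move=> [p1 a1] [p2 a2]; split; first by rewrite !labels_cat perm_cat.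
by move=> e r /adj_cat [/a1 ? /a2 ?]; apply/adj_cat.
Qed.

Lemma resib_catC (T : eqType) (F G : forest T) : resib (fcat F G) (fcat G F).
Proof.
split; first by rewrite !labels_cat perm_catC.
by move=> e r /adj_cat [? ?]; apply/adj_cat.
Qed.

Lemma resib_node (T : eqType) a (F G : forest T) :
  resib F G -> resib (Cons a F Nil) (Cons a G Nil).
Proof.
move=> [p h]; split; first by rewrite /= !cats0 perm_cons.
by move=> e r /= [? /h ? _].
Qed.

(* At every step the imbalance [|x - y|] is at most the size of what is left:
   it is repaired by hanging the smaller part on the lighter side. *)
Lemma comb_balance (T : eqType) (F : forest T) (x y : Z) :
  x <= y + fsz F -> y <= x + fsz F ->
  exists C, [/\ resib F (cforest C),
    2 * (x + fsz (cleft C)) <= x + y + fsz F &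
    2 * (y + fsz (cright C)) <= x + y + fsz F].
Proof.
have [n hn] : exists n, fsz F <= Z.of_nat n by exists (Z.to_nat (fsz F)); lia.
elim: n F hn x y => [|n IH] F hn x y hx hy.
  case: F hn hx hy => [|a ch sib] /=; last by have := fsz_ge0 ch; have := fsz_ge0 sib; lia.
  by move=> _ hx hy; exists CNil; split=> //=; lia.
have hang G H : 0 < fsz G -> fsz G <= fsz H -> resib F (fcat G H) ->
  exists C, [/\ resib F (cforest C),
    2 * (x + fsz (cleft C)) <= x + y + fsz F &
    2 * (y + fsz (cright C)) <= x + y + fsz F].
  move=> G0 GH FGH.
  have sF : fsz F = fsz G + fsz H.
    by rewrite -fsz_cat; apply: fsz_perm; case: FGH.
  case: (Z_le_gt_dec x y) => hxy.
  - have [|||C [rC lC cC]] := IH H _ (x + fsz G) y; try lia.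
    exists (CLeft G C); rewrite /= fsz_cat; split; try lia.
    by apply: resib_trans FGH _; apply: resib_cat rC.
  - have [|||C [rC lC cC]] := IH H _ x (y + fsz G); try lia.
    exists (CRight C G); rewrite /= fsz_cat; split; try lia.
    apply: resib_trans FGH _; apply: resib_trans (resib_catC _ _) _.
    exact: resib_cat.
case: F hn hx hy hang => [|a ch sib] /= hn hx hy hang.
  by exists CNil; split=> //=; lia.
have hch := fsz_ge0 ch; have hsib := fsz_ge0 sib.
have rF : resib (Cons a ch sib) (fcat (Cons a ch Nil) sib) by apply: resib_refl.
case: sib hn hx hy hang hsib rF => [|b bch bsib] hn hx hy hang hsib rF.
- rewrite /= in hx hy hn *.
  (* A single tree is left. If the imbalance equals its size, hanging it whole on the lighter side
     balances exactly; otherwise its root extends the stem. *)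
  case: (Z_le_gt_dec x (y + fsz ch)) => h1; last first.
    exists (CRight CNil (Cons a ch Nil)) => /=; split=> //; lia.
  case: (Z_le_gt_dec y (x + fsz ch)) => h2; last first.
    exists (CLeft (Cons a ch Nil) CNil) => /=; split=> //; lia.
  have [|||C [rC lC cC]] := IH ch _ x y; try lia.
  exists (CStem a C) => /=; split; try lia.
  exact: resib_node.
- set sib := Cons b bch bsib in hn hx hy hang hsib rF *.
  have s0 : 0 < fsz sib by rewrite /=; have := fsz_ge0 bch; have := fsz_ge0 bsib; lia.
  have tE : fsz (Cons a ch Nil) = 1 + fsz ch by rewrite /=; lia.
  case: (Z_le_gt_dec (1 + fsz ch) (fsz sib)) => hs.
  + by apply: hang rF; rewrite tE; lia.
  + by apply: hang (resib_trans rF (resib_catC _ _)); rewrite ?tE //; lia.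
Qed.

(** Used for the eastward path, where everything hangs on the south side; the length of the stem is
    kept. *)
Fixpoint all_left A (C : comb A) : comb A :=
  match C with
  | CNil => CNil
  | CLeft G C => CLeft G (all_left C)
  | CRight C G => CLeft G (all_left C)
  | CStem a C => CStem a (all_left C)
  end.

Lemma all_left_right A (C : comb A) : cright (all_left C) = Nil.
Proof. by elim: C. Qed.

Lemma all_left_stem A (C : comb A) : cstem (all_left C) = cstem C.
Proof. by elim: C => //= a C ->. Qed.

Lemma all_left_resib (T : eqType) (C : comb T) :
  resib (cforest C) (cforest (all_left C)).
Proof.
elim: C => [|G C IH|C IH G|a C IH] /=; first exact: resib_refl.
- exact: resib_cat.
- by apply: resib_trans (resib_catC _ _) _; apply: resib_cat.
- exact: resib_node.
Qed.

(** * Spanning trees and centroids *)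

Lemma insert_leaf (T : eqType) (e : rel T) r F x z :
  adj e r F -> x \in r :: labels F -> e x z ->
  exists F', adj e r F' /\ perm_eq (labels F') (z :: labels F).
Proof.
elim: F r => [|a ch IH1 sib IH2] r.
  by move=> _ /=; rewrite inE => /eqP -> exz; exists (Cons z Nil Nil).
move=> /= [h1 h2 h3] hx exz.
have [/eqP xr|[hx'|hx']] : x == r \/ x \in a :: labels ch \/ x \in r :: labels sib.
- by move: hx; rewrite !inE mem_cat => /or4P [] h;
    [left | right; left | right; left | right; right]; rewrite ?in_cons h ?orbT.
- by rewrite xr in exz; exists (Cons z Nil (Cons a ch sib)).
- have [G [aG pG]] := IH1 _ h2 hx' exz; exists (Cons a G sib); split=> //=.
  apply: perm_trans (_ : perm_eq _ (a :: z :: labels ch ++ labels sib)) _.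
    by rewrite perm_cons -cat_cons perm_cat2r.
  by apply/permPl; exact: (perm_catCA [:: a] [:: z]).
- have [G [aG pG]] := IH2 _ h3 hx' exz; exists (Cons a ch G); split=> //=.
  apply: perm_trans (_ : perm_eq _ ((a :: labels ch) ++ z :: labels sib)) _.
    by rewrite -cat_cons perm_cat2l.
  by apply/permPl; exact: (perm_catCA (a :: labels ch) [:: z]).
Qed.

Lemma spanning_forest (T : finType) (e : rel T) (r : T) :
  (forall x y, connect e x y) ->
  exists F, adj e r F /\ perm_eq (r :: labels F) (enum T).
Proof.
move=> conn.
have grow k : (k < #|T|)%N -> exists F,
    [/\ adj e r F, uniq (r :: labels F) & size (labels F) = k].
  elim: k => [|k IH] hk; first by exists Nil.
  have [F [aF uF sF]] := IH (ltnW hk).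
  (* Some edge leaves the set reached so far: follow a path from [r] to a missing vertex. *)
  have [x hx [z hz exz]] : exists2 x, x \in r :: labels F &
      exists2 z, z \notin r :: labels F & e x z.
    have [y hy] : exists y, y \notin r :: labels F.
      apply/existsP; rewrite -negb_forall; apply/negP => /forallP hall.
      have : (#|T| <= size (r :: labels F))%N.
        by rewrite cardE uniq_leq_size ?enum_uniq // => t _; apply: hall.
      by rewrite /= sF leqNgt hk.
    have /connectP [p pp yE] := conn r y.
    rewrite {y}yE in hy; move: pp hy (mem_head r (labels F)).
    move: {aF uF sF IH} (r :: labels F) => S; elim: p r => [|b p IHp] a /=; first by move=> _ /negP.
    move=> /andP [eab pp] hy ha.
    case: (boolP (b \in S)) => hb; first exact: IHp hb.
    by exists a => //; exists b.
  have [G [aG pG]] := insert_leaf aF hx exz.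
  exists G; split=> //; last by rewrite (perm_size pG) /= sF.
  have -> : uniq (r :: labels G) = uniq (z :: r :: labels F).
    apply: perm_uniq; have := pG; rewrite -(perm_cons r) => h.
    by apply: perm_trans h _; apply/permPl; exact: (perm_catCA [:: r] [:: z]).
  by rewrite cons_uniq hz.
have T0 : (0 < #|T|)%N by apply/card_gt0P; exists r.
have [F [aF uF sF]] := grow #|T|.-1 ltac:(by rewrite prednK).
exists F; split=> //; apply: uniq_perm => //; first exact: enum_uniq.
have [] := @uniq_min_size _ (r :: labels F) (enum T) uF _ _ => //.
- by move=> t _; rewrite mem_enum.
- by rewrite -cardE /= sF prednK.
Qed.

Fixpoint small_trees A (n : Z) (F : forest A) : Prop :=
  if F is Cons _ ch sib then 2 * (1 + fsz ch) <= n /\ small_trees n sib else True.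

Lemma pick_tree (T : eqType) (n : Z) (F : forest T) :
  small_trees n F \/
  exists b ch G, n < 2 * (1 + fsz ch) /\ resib F (Cons b ch G).
Proof.
elim: F => [|a ch _ sib IH]; first by left.
case: (Z_le_gt_dec (2 * (1 + fsz ch)) n) => h; last first.
  by right; exists a, ch, sib; split; [lia | apply: resib_refl].
case: IH => [hs|[b [bch [G [hb rG]]]]]; first by left.
right; exists b, bch, (Cons a ch G); split=> //.
have := resib_cat (resib_refl (Cons a ch Nil)) rG => /resib_trans; apply.
have := resib_catC (Cons a ch Nil) (Cons b bch Nil) => hC.
exact: (resib_cat hC (resib_refl G)).
Qed.

(* Walk the root into the subtree of more than [n / 2] nodes. *)
Lemma centroid_walk (T : eqType) (e : rel T) (n : Z) r b (ch G : forest T) :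
  symmetric e -> e r b -> adj e b ch -> adj e r G ->
  n = 2 + fsz ch + fsz G -> n < 2 * (1 + fsz ch) ->
  exists r' F', [/\ adj e r' F', perm_eq (r' :: labels F') (r :: b :: labels ch ++ labels G) &
    small_trees n F'].
Proof.
move=> esym.
have [k hk] : exists k, fsz ch <= Z.of_nat k by exists (Z.to_nat (fsz ch)); lia.
elim: k r b ch G hk => [|k IH] r b ch G hk erb ach aG hn hb.
  by have := fsz_ge0 G; lia.
have perm1 : perm_eq (b :: r :: labels G ++ labels ch) (r :: b :: labels ch ++ labels G).
  apply: perm_trans (_ : perm_eq _ (r :: b :: labels G ++ labels ch)) _.
    by apply/permPl; exact: (perm_catCA [:: b] [:: r]).
  by rewrite !perm_cons perm_catC.
case: (pick_tree n ch) => [hs|[c [cch [H [hc [pc ac]]]]]].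
  (* [b] becomes the root. The new subtree at [r] has [n - 1 - fsz ch] nodes, less than half of
     [n]. *)
  by exists b, (Cons r G ch); split=> //=; [rewrite esym | split=> //; lia].
have /= [ebc acc aH] := ac _ _ ach.
have sc := fsz_perm pc; rewrite /= in sc.
have hH := fsz_ge0 H.
have [||||r' [F' [aF' pF' sF']]] := IH b c cch (Cons r G H) _ ebc acc => //=; try lia.
  by rewrite esym.
exists r', F'; split=> //; apply: perm_trans pF' _; apply: perm_trans perm1.
rewrite perm_cons perm_sym; apply: perm_trans (perm_cat (perm_refl (r :: labels G)) pc) _.
by apply/permPl; exact: (perm_catCA (r :: labels G) (c :: labels cch)).
Qed.

Lemma centroid (T : eqType) (e : rel T) r (F : forest T) :
  symmetric e -> adj e r F ->
  exists r' F', [/\ adj e r' F', perm_eq (r' :: labels F') (r :: labels F) &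
    small_trees (1 + fsz F) F'].
Proof.
move=> esym aF.
case: (pick_tree (1 + fsz F) F) => [hs|[b [ch [G [hb [pF aF']]]]]]; first by exists r, F.
have /= [erb ab aG] := aF' _ _ aF.
have sF := fsz_perm pF; rewrite /= in sF.
have [|r' [F' [aR pR sR]]] := centroid_walk esym erb ab aG _ hb; first lia.
exists r', F'; split=> //; apply: perm_trans pR _.
by rewrite perm_cons perm_sym.
Qed.

(** A new tree [t] makes four groups. Either [X] and [Y] together have at most [m / 2] nodes, or [Z]
    and [t] do; that pair is merged. *)
Lemma three_groups (T : eqType) (m : Z) (F : forest T) :
  fsz F <= m -> small_trees (m + 1) F ->
  exists F1 F2 F3, [/\ resib F (fcat F1 (fcat F2 F3)),
    2 * fsz F1 <= m + 1, 2 * fsz F2 <= m + 1 & 2 * fsz F3 <= m + 1].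
Proof.
elim: F => [|a ch _ sib IH] /= hm.
  by exists Nil, Nil, Nil; split=> //=; lia.
move=> [hs /IH {}IH].
have hch := fsz_ge0 ch; have hsib := fsz_ge0 sib.
have [|X [Y [Z [rs hX hY hZ]]]] := IH; first lia.
have sE : fsz sib = fsz X + fsz Y + fsz Z.
  by rewrite (fsz_perm (proj1 rs)) !fsz_cat; lia.
set t := Cons a ch Nil.
have tE : fsz t = 1 + fsz ch by rewrite /=; lia.
have rt : resib (Cons a ch sib) (fcat t (fcat X (fcat Y Z))).
  exact: (resib_cat (resib_refl t) rs).
case: (Z_le_gt_dec (2 * (fsz X + fsz Y)) m) => hXY.
- exists t, (fcat X Y), Z; split; rewrite ?fsz_cat; try lia.
  apply: resib_trans rt _; apply: resib_cat (resib_refl _) _.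
  by rewrite fcatA; apply: resib_refl.
- exists (fcat Z t), X, Y; split; rewrite ?fsz_cat; try lia.
  apply: resib_trans rt _.
  apply: resib_trans (resib_catC _ _) _.
  have -> : fcat (fcat X (fcat Y Z)) t = fcat (fcat X Y) (fcat Z t).
    by rewrite !fcatA.
  exact: resib_catC.
Qed.

(** * Assembling the drawing *)

Lemma fits_cat (T : eqType) (pos : T -> point) r D E :
  fits pos r (fcat D E) <-> fits pos r D /\ fits pos r E.
Proof.
elim: D => [|a ch _ sib IH] /=; first by split=> [|[]].
split=> [[h1 h2 /IH [h3 h4]] | [[h1 h2 h3] h4]]; first by [].
by split=> //; apply/IH.
Qed.

(** Supplies the slope of a line flat enough to have all of the north group above it. *)
Lemma vin_abs_bound A (D : forest (A * point)) :
  exists K, forall x, vin x D -> Z.abs (fst x) < K.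
Proof.
elim: D => [|a ch [K1 h1] sib [K2 h2]]; first by exists 0.
exists (Z.max (Z.abs (fst (snd a)) + 1) (Z.max K1 K2)) => x /= [->|/h1|/h2]; lia.
Qed.

(** The horizontal stem uses no height to the south, so only the hanging nodes count there. *)
Lemma draw_east A (C : comb A) : cright C = Nil ->
  exists D, [/\ erase D = cforest C, good D,
    forall x, vin x D -> 1 <= fst x /\ snd x <= 0,
    bnd (1, 0) (fsz (cforest C)) D & bnd (0, -1) (fsz (cleft C)) D].
Proof.
move=> rC.
have [||||| X [eX gX hX bX1 bX2]] :=
  @quadrant_draw _ (cleft C) (0, -1) (1, 0) (0, -1) (1, 0) => //.
have {}hX x : vin x X -> 1 <= fst x /\ snd x <= -1.
  by move=> /hX [i [j [hi hj ->]]] /=; lia.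
have [|||||| D [eD gD vD bD]] := @comb_draw _ (1, 0) C X Nil eX => //.
  by move=> x /hX; rewrite /cross /=; lia.
have hl := fsz_ge0 (cleft C).
exists D; split=> //.
- by move=> x /vD [/hX|->|//] /=; lia.
- apply: bD bX2 (I : bnd _ 0 Nil) _; apply: budget_stem (Z.le_refl _) _ _ => //.
  by rewrite comb_size rC /dot /=; lia.
- apply: bD bX1 (I : bnd _ 0 Nil) _; apply: budget_stem (Z.le_refl _) _ _ => //.
  by rewrite /dot /=; lia.
Qed.

(** The vertical stem uses no width: the left part alone counts to the east, the right part alone to
    the west. *)
Lemma draw_north A (C : comb A) :
  exists D, [/\ erase D = cforest C, good D, forall x, vin x D -> 1 <= snd x,
    bnd (0, 1) (cstem C + Z.max (fsz (cleft C)) (fsz (cright C))) D &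
    bnd (1, 0) (fsz (cleft C)) D /\ bnd (-1, 0) (fsz (cright C)) D].
Proof.
have [||||| X [eX gX hX bX1 bX2]] :=
  @quadrant_draw _ (cleft C) (1, 0) (0, 1) (1, 0) (0, 1) => //.
have {}hX x : vin x X -> 1 <= fst x /\ 1 <= snd x.
  by move=> /hX [i [j [hi hj ->]]] /=; lia.
have [||||| Y [eY gY hY bY1 bY2]] :=
  @quadrant_draw _ (cright C) (0, 1) (-1, 0) (0, 1) (-1, 0) => //.
have {}hY x : vin x Y -> fst x <= -1 /\ 1 <= snd x.
  by move=> /hY [i [j [hi hj ->]]] /=; lia.
have [||| D [eD gD vD bD]] := @comb_draw _ (0, 1) C X Y eX eY gX gY.
- by move=> x /hX; rewrite /cross /=; lia.
- by move=> x /hY; rewrite /cross /=; lia.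
- by move=> x y /hX hx /hY hy; rewrite /cross /=; nia.
have hl := fsz_ge0 (cleft C); have hr := fsz_ge0 (cright C).
exists D; split=> //; last split.
- by move=> x /vD [/hX|->|/hY] /=; lia.
- apply: bD bX2 bY1 _.
  by apply: (@budget_stem _ _ _ _ _ (Z.max (fsz (cleft C)) (fsz (cright C))));
    rewrite /dot /=; lia.
- have bY : bnd (1, 0) (fsz (cleft C)) Y.
    by apply: bnd_nonpos => // x /hY; rewrite /dot /=; lia.
  by apply: bD bX1 bY _; apply: budget_stem (Z.le_refl _) _ _; rewrite /dot /=; lia.
- have bX : bnd (-1, 0) (fsz (cright C)) X.
    by apply: bnd_nonpos => // x /hX; rewrite /dot /=; lia.
  by apply: bD bX bY2 _; apply: (@budget_stem _ _ _ _ _ (fsz (cright C))); rewrite /dot /=; lia.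
Qed.

(** [m] is the number of edges; for [n = m + 1] the bound [(3 * m + 5) / 4] equals
    [3 * (n + 2) / 4 - 1]. *)
Definition compact_drawing (T : eqType) (e : rel T) (m : Z) : Prop :=
  exists pos : T -> point, (forall u v, mconn e pos u v) /\
  exists x0 y0, forall t,
    (x0 <= fst (pos t) /\ 4 * (fst (pos t) - x0) <= 3 * m + 5) /\
    (y0 <= snd (pos t) /\ 4 * (snd (pos t) - y0) <= 3 * m + 5).

Lemma draw_groups (T : eqType) (e : rel T) (r : T) (F1 F2 F3 : forest T)
    (C1 C2 : comb T) (m : Z) :
  symmetric e -> adj e r F1 -> adj e r F2 -> adj e r F3 ->
  uniq (r :: labels F1 ++ labels F2 ++ labels F3) ->
  (forall t, t \in r :: labels F1 ++ labels F2 ++ labels F3) ->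
  resib F1 (cforest C1) -> resib F2 (cforest C2) ->
  m = fsz F1 + fsz F2 + fsz F3 ->
  2 * fsz F1 <= m + 1 -> 2 * fsz F2 <= m + 1 ->
  fsz F3 <= fsz F1 -> fsz F3 <= fsz F2 ->
  2 * fsz (cleft C2) <= fsz F2 -> 2 * fsz (cright C2) <= fsz F2 ->
  cstem C2 <= cstem C1 -> compact_drawing e m.
Proof.
move=> esym a1 a2 a3 uT cT r1 r2 mE h1 h2 h31 h32 hl hr hs.
have {}r1 := resib_trans r1 (all_left_resib C1).
rewrite -(all_left_stem C1) in hs.
move: (all_left C1) (all_left_right C1) r1 hs => {}C1 rC1 r1 hs.
have [p1 /(_ _ _ a1) {}a1] := r1; have [p2 /(_ _ _ a2) {}a2] := r2.
have s1 := fsz_perm p1; have s2 := fsz_perm p2.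
have [D1 [e1 g1 v1 b1E b1S]] := draw_east rC1.
have [D2 [e2 g2 v2 b2N [b2E b2W]]] := draw_north C2.
have [||||| D3 [e3 g3 v3 b3W b3S]] :=
  @quadrant_draw _ F3 (-1, 0) (0, -1) (-1, 0) (0, -1) => //.
have {}v3 x : vin x D3 -> fst x <= -1 /\ snd x <= -1.
  by move=> /v3 [i [j [hi hj ->]]] /=; lia.
rewrite -e1 in a1; rewrite -e2 in a2; rewrite -e3 in a3.
have pT : perm_eq (r :: labels F1 ++ labels F2 ++ labels F3)
                  (r :: labels (erase (fcat D1 (fcat D2 D3)))).
  by rewrite !fmap_cat !labels_cat e1 e2 e3 perm_cons !perm_cat.
have [|pos [pos_r]] := @fits_exists _ r (fcat D1 (fcat D2 D3)) (0, 0).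
  by rewrite -(perm_uniq pT).
move=> /fits_cat [f1 /fits_cat [f2 f3]].
have memT t : [\/ t = r, t \in labels (erase D1), t \in labels (erase D2) |
               t \in labels (erase D3)].
  have := cT t; rewrite (perm_mem pT) !fmap_cat !labels_cat inE !mem_cat.
  by case/or4P => [/eqP|||]; [constructor 1 | constructor 2 | constructor 3 | constructor 4].
(* Each group lies in an open half-plane, so [good_mono] applies to it. The three together need not,
   so they are separated pair by pair. *)
have m1 : mono D1 by apply: (@good_mono _ (1, 0)) g1 => x /v1; rewrite /dot /=; lia.
have m2 : mono D2 by apply: (@good_mono _ (0, 1)) g2 => x /v2; rewrite /dot /=; lia.
have m3 : mono D3 by apply: (@good_mono _ (-1, 0)) g3 => x /v3; rewrite /dot /=; lia.
have [K hK] := vin_abs_bound D2.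
have c12 u v : u \in r :: labels (erase D1) -> v \in r :: labels (erase D2) ->
    mconn e pos u v /\ mconn e pos v u.
  apply: (@separated_mconn _ _ _ esym (-1, Z.max K 0)) a1 a2 f1 f2 _ _.
  - by move=> x /v1; rewrite /dot /=; nia.
  - by move=> x hx; have := hK x hx; have := v2 x hx; rewrite /dot /=; nia.
have c13 u v : u \in r :: labels (erase D1) -> v \in r :: labels (erase D3) ->
    mconn e pos u v /\ mconn e pos v u.
  apply: (@separated_mconn _ _ _ esym (-1, 0)) a1 a3 f1 f3 _ _.
  - by move=> x /v1; rewrite /dot /=; lia.
  - by move=> x /v3; rewrite /dot /=; lia.
have c23 u v : u \in r :: labels (erase D2) -> v \in r :: labels (erase D3) ->
    mconn e pos u v /\ mconn e pos v u.
  apply: (@separated_mconn _ _ _ esym (0, -1)) a2 a3 f2 f3 _ _.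
  - by move=> x /v2; rewrite /dot /=; lia.
  - by move=> x /v3; rewrite /dot /=; lia.
have memT' t : [\/ t \in r :: labels (erase D1), t \in r :: labels (erase D2) |
               t \in r :: labels (erase D3)].
  case: (memT t) => [->|h|h|h].
  - by constructor 1; rewrite mem_head.
  - by constructor 1; rewrite in_cons h orbT.
  - by constructor 2; rewrite in_cons h orbT.
  - by constructor 3; rewrite in_cons h orbT.
exists pos; split.
  move=> u v; case: (memT' u) => hu; case: (memT' v) => hv.
  - exact: mono_mconn a1 f1 m1 hu hv.
  - exact: (proj1 (c12 _ _ hu hv)).
  - exact: (proj1 (c13 _ _ hu hv)).
  - exact: (proj2 (c12 _ _ hv hu)).
  - exact: mono_mconn a2 f2 m2 hu hv.
  - exact: (proj1 (c23 _ _ hu hv)).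
  - exact: (proj2 (c13 _ _ hv hu)).
  - exact: (proj2 (c23 _ _ hv hu)).
  - exact: mono_mconn a3 f3 m3 hu hv.
have z1 : bnd (-1, 0) 0 D1 by apply: bnd_nonpos => // x /v1; rewrite /dot /=; lia.
have z1' : bnd (0, 1) 0 D1 by apply: bnd_nonpos => // x /v1; rewrite /dot /=; lia.
have z2 : bnd (0, -1) 0 D2 by apply: bnd_nonpos => // x /v2; rewrite /dot /=; lia.
have z3 : bnd (1, 0) 0 D3 by apply: bnd_nonpos => // x /v3; rewrite /dot /=; lia.
have z3' : bnd (0, 1) 0 D3 by apply: bnd_nonpos => // x /v3; rewrite /dot /=; lia.
have q1 := comb_size C1; have q2 := comb_size C2; rewrite rC1 /= in q1.
have n1 := cstem_ge0 C1; have n2 := cstem_ge0 C2; have n3 := fsz_ge0 F3.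
have n4 := fsz_ge0 (cleft C2); have n5 := fsz_ge0 (cright C2); have n6 := fsz_ge0 (cleft C1).
(* The root is at the origin, and the corner is the reach to the west and south. With group sizes
   [c1], [c2], [c3], the critical extents are [c1 + c2 / 2], [c1 + c3] and [c2 + c3], each at most
   [(3 * m + 1) / 4]; for the height, [cstem C2 <= cstem C1] cancels the stems. *)
exists (- Z.max (fsz (cright C2)) (fsz F3)), (- Z.max (fsz (cleft C1)) (fsz F3)) => t.
case: (memT t) => [->|ht|ht|ht].
- by rewrite pos_r /=; lia.
- have := fits_bnd f1 b1E ht; have := fits_bnd f1 b1S ht.
  have := fits_bnd f1 z1 ht; have := fits_bnd f1 z1' ht.
  by rewrite pos_r /dot /=; lia.
- have := fits_bnd f2 b2N ht; have := fits_bnd f2 b2E ht.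
  have := fits_bnd f2 b2W ht; have := fits_bnd f2 z2 ht.
  by rewrite pos_r /dot /=; lia.
- have := fits_bnd f3 b3W ht; have := fits_bnd f3 b3S ht.
  have := fits_bnd f3 z3 ht; have := fits_bnd f3 z3' ht.
  by rewrite pos_r /dot /=; lia.
Qed.

Lemma compact_drawing_exists (T : eqType) (e : rel T) (r0 : T) (F0 : forest T) :
  symmetric e -> adj e r0 F0 -> uniq (r0 :: labels F0) ->
  (forall t, t \in r0 :: labels F0) -> compact_drawing e (fsz F0).
Proof.
move=> esym aF0 uT cT.
have [r [F [aF pF sF]]] := centroid esym aF0.
have sFF : fsz F = fsz F0.
  by move/perm_size: (pF); rewrite !fsz_labels /= => -[->].
rewrite -sFF Z.add_comm in sF; rewrite -sFF.
have [G1 [G2 [G3 [[pG aG] k1 k2 k3]]]] := three_groups (Z.le_refl _) sF.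
have /adj_cat [aG1 /adj_cat [aG2 aG3]] := aG _ _ aF.
have sE := fsz_perm pG; rewrite !fsz_cat in sE.
rewrite !labels_cat in pG.
have {}pG : perm_eq (r0 :: labels F0) (r :: labels G1 ++ labels G2 ++ labels G3).
  by rewrite perm_sym; apply: perm_trans pF; rewrite perm_cons perm_sym.
(* Only the third group has to be smallest; the first two are exchanged according to the lengths of
   their stems, which are known only after balancing. *)
have sorted (H1 H2 H3 : forest T) : adj e r H1 -> adj e r H2 -> adj e r H3 ->
    perm_eq (labels G1 ++ labels G2 ++ labels G3) (labels H1 ++ labels H2 ++ labels H3) ->
    fsz F = fsz H1 + fsz H2 + fsz H3 ->
    2 * fsz H1 <= fsz F + 1 -> 2 * fsz H2 <= fsz F + 1 ->
    fsz H3 <= fsz H1 -> fsz H3 <= fsz H2 -> compact_drawing e (fsz F).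
  move=> aH1 aH2 aH3 pH sH q1 q2 q31 q32.
  have {}pH : perm_eq (r0 :: labels F0) (r :: labels H1 ++ labels H2 ++ labels H3).
    by apply: perm_trans pG _; rewrite perm_cons.
  have uH : uniq (r :: labels H1 ++ labels H2 ++ labels H3).
    by rewrite -(perm_uniq pH).
  have cH t : t \in r :: labels H1 ++ labels H2 ++ labels H3.
    by rewrite -(perm_mem pH).
  have hH1 := fsz_ge0 H1.
  have [||C1 [r1 l1 c1]] := @comb_balance _ H1 0 0; [lia | lia |].
  have hH2 := fsz_ge0 H2.
  have [||C2 [r2 l2 c2]] := @comb_balance _ H2 0 0; [lia | lia |].
  case: (Z_le_gt_dec (cstem C2) (cstem C1)) => hC.
  - by apply: (draw_groups esym aH1 aH2 aH3 uH cH r1 r2) => //; lia.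
  - have pS : perm_eq (r :: labels H1 ++ labels H2 ++ labels H3)
                      (r :: labels H2 ++ labels H1 ++ labels H3).
      by rewrite perm_cons; apply/permPl; exact: perm_catCA.
    apply: (draw_groups esym aH2 aH1 aH3 _ _ r2 r1) => //; try lia.
      by rewrite -(perm_uniq pS).
    by move=> t; rewrite -(perm_mem pS).
case: (Z_le_gt_dec (fsz G3) (fsz G1)) => q1; case: (Z_le_gt_dec (fsz G3) (fsz G2)) => q2;
  case: (Z_le_gt_dec (fsz G1) (fsz G2)) => q3.
all: try by apply: (sorted G1 G2 G3) => //; lia.
all: try by (apply: (sorted G1 G3 G2) => //; try lia; rewrite perm_cat2l perm_catC).
all: by (apply: (sorted G2 G3 G1) => //; try lia; rewrite perm_catC -catA).
Qed.

(** * Real directions, injectivity and the grid *)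

Lemma mconn_monotone (T : eqType) (e : rel T) (pos : T -> point) u v :
  mconn e pos u v ->
  exists p, path e u p /\ last u p = v /\ monotone_path pos u p.
Proof.
move=> [d [p [hp lp]]]; exists p; split; last split=> //.
  by apply: sub_path hp => x y /andP [].
exists (IZR (fst d), IZR (snd d)) => i hi.
have /andP [_ /Z.ltb_lt h] := pathP u hp i hi.
rewrite /proj_diff /= -!mult_IZR -plus_IZR; apply: (IZR_lt 0).
by move: h; rewrite /dot /=; lia.
Qed.

(** [dot d] increases strictly along a nonempty path, so distinctness of the points follows from
    monotonicity. *)
Lemma mconn_neq (T : eqType) (e : rel T) (pos : T -> point) u v :
  mconn e pos u v -> u <> v -> pos u <> pos v.
Proof.
move=> [d [p [hp lp]]] uv puv.
have key q w : path (stepd e pos d) w q -> dot d (pos w) <= dot d (pos (last w q)) /\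
    (q <> [::] -> dot d (pos w) < dot d (pos (last w q))).
  elim: q w => [|b q IH] w /=; first by split=> //; lia.
  move=> /andP [/andP [_ /Z.ltb_lt h] /IH [h1 _]].
  by move: h h1; rewrite /dot /=; lia.
case: p hp lp => [|b p] hp lp; first exact: uv.
have [_ h] := key _ _ hp.
by have := h ltac:(by []); rewrite lp puv; lia.
Qed.

Theorem theorem6 (T : finType) (e : rel T) :
  is_tree e -> (0 < #|T|)%N ->
  exists pos : T -> point,
    injective pos /\
    in_grid pos ((3 * (#|T| + 2)) %/ 4)%N /\
    monotone_drawing e pos.
Proof.
move=> [[esym _] [conn _]] /card_gt0P [r0 _].
have [F [aF pF]] := spanning_forest r0 conn.
have [||pos [hm [x0 [y0 hb]]]] := compact_drawing_exists esym aF.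
- by rewrite (perm_uniq pF) enum_uniq.
- by move=> t; rewrite (perm_mem pF) mem_enum.
(* The forest omits the root, so its nodes number one less than the vertices. *)
have mE : fsz F = Z.of_nat #|T| - 1.
  by rewrite fsz_labels cardE -(perm_size pF) /=; lia.
rewrite mE in hb.
exists pos; split; last split.
- move=> u v puv; apply/eqP; apply/negPn/negP => /eqP uv.
  exact: (mconn_neq (hm u v) uv).
- exists x0, y0 => t.
  (* [3 * (n - 1) + 5 = 3 * (n + 2) - 4], and the remainder is below [4], so an integral span is at
     most the quotient minus [1]. *)
  have := divn_eq (3 * (#|T| + 2)) 4.
  have := ltn_pmod (3 * (#|T| + 2)) (isT : 0 < 4)%N.
  move: ((3 * (#|T| + 2)) %/ 4)%N ((3 * (#|T| + 2)) %% 4)%N => q s /ltP hs.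
  rewrite -!plusE -!multE => hq.
  by have := hb t; lia.
- by move=> u v; apply: mconn_monotone.
Qed.
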